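(* For every $p\in(0,1)$ and every $n$-vertex graph $G$, we have $t_p(G) = p\,t(G) + O(n)$.
   Context: Toppling game: on a graph $G$, chips are placed on vertices; a vertex with at least $\deg(v)$ chips may fire, losing $\deg(v)$ chips and sending one chip to each neighbour; a configuration is volatile if there is an infinite sequence of vertices that may be fired in order. Max and Min alternately place one chip on a vertex (Max first); the game ends when the configuration becomes volatile; Max maximizes and Min minimizes the number of chips placed; $t(G)$ is the length under optimal play. Fractional toppling game with parameter $p\in(0,1)$: identical, except a vertex $v$ may fire once it holds at least $p\deg(v)$ chips, and firing removes $p\deg(v)$ chips from $v$ and adds $p$ chips to each neighbour of $v$ (chip amounts may be non-integral; each player still places exactly one chip per turn); volatility is defined with these firing rules. $t_p(G)$ is the length of the fractional game when Max starts and both play optimally. *)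

(* Defs.v *)
From HB Require Import structures.
From mathcomp Require Import all_boot all_order all_algebra reals.

Set Implicit Arguments.
Unset Strict Implicit.
Unset Printing Implicit Defensive.

Import Order.TTheory GRing.Theory Num.Theory.

Local Open Scope ring_scope.

(* A simple graph is a symmetric irreflexive relation e on a finType. *)
Definition degree (V : finType) (e : rel V) (v : V) : nat :=
  #|[set w | e v w]|.

(* The truncated subtraction is exact whenever v may fire, i.e. whenever
   degree e v <= c v. Nothing excludes degree 0: an isolated vertex may always
   fire, so in a graph with an isolated vertex every configuration is
   volatile. *)
Definition fire (V : finType) (e : rel V) (c : V -> nat) (v : V) : V -> nat :=
  fun w => (if w == v then c w - degree e v else c w + e v w)%N.

Fixpoint fire_seq (V : finType) (e : rel V) (c : V -> nat) (s : nat -> V)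
    (k : nat) : V -> nat :=
  if k is k'.+1 then fire e (fire_seq e c s k') (s k') else c.

Definition volatile (V : finType) (e : rel V) (c : V -> nat) : Prop :=
  exists s : nat -> V,
    forall k, (degree e (s k) <= fire_seq e c s k (s k))%N.

Definition frac_fire (R : realType) (p : R) (V : finType) (e : rel V)
    (c : V -> R) (v : V) : V -> R :=
  fun w => if w == v then c w - p * (degree e v)%:R else c w + p * (e v w)%:R.

Fixpoint frac_fire_seq (R : realType) (p : R) (V : finType) (e : rel V)
    (c : V -> R) (s : nat -> V) (k : nat) : V -> R :=
  if k is k'.+1 then frac_fire p e (frac_fire_seq p e c s k') (s k') else c.

Definition frac_volatile (R : realType) (p : R) (V : finType) (e : rel V)
    (c : V -> R) : Prop :=
  exists s : nat -> V,
    forall k, p * (degree e (s k))%:R <= frac_fire_seq p e c s k (s k).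

(* Players only ever place whole chips, and firing serves only to decide when
   the game is over; so in both games the position is the list of vertices
   chosen so far, and the games differ only in the predicate [over] on the
   resulting chip counts. A strategy reads the whole history; Max moves after
   an even number of chips, Min after an odd number. *)
Definition chips (V : finType) (h : seq V) : V -> nat := fun v => count_mem v h.

Fixpoint play (V : finType) (smax smin : seq V -> V) (k : nat) : seq V :=
  if k is k'.+1 then
    let h := play smax smin k' in
    rcons h ((if odd k' then smin else smax) h)
  else [::].

Definition ends_at (V : finType) (over : (V -> nat) -> Prop)
    (smax smin : seq V -> V) (k : nat) : Prop :=
  over (chips (play smax smin k)) /\
  forall j, (j < k)%N -> ~ over (chips (play smax smin j)).

(* L is the value of the game: Max can force at least L chips (a play that
   never ends counts as infinitely long) and Min can force at most L. *)
Definition optimal_length (V : finType) (over : (V -> nat) -> Prop)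
    (L : nat) : Prop :=
  (exists smax : seq V -> V, forall (smin : seq V -> V) (k : nat),
     ends_at over smax smin k -> (L <= k)%N) /\
  (exists smin : seq V -> V, forall smax : seq V -> V,
     exists2 k : nat, ends_at over smax smin k & (k <= L)%N).

Lemma optimal_length_unique (V : finType) (over : (V -> nat) -> Prop)
    (L1 L2 : nat) :
  optimal_length over L1 -> optimal_length over L2 -> L1 = L2.
Proof.
have le_len A B : optimal_length over A -> optimal_length over B -> (A <= B)%N.
  move=> [[smax Hmax] _] [_ [smin Hmin]].
  by have [k Hk] := Hmin smax; apply: leq_trans; apply: Hmax Hk.
by move=> H1 H2; apply/eqP; rewrite eqn_leq !le_len.
Qed.

Definition is_toppling_number (V : finType) (e : rel V) (t : nat) : Prop :=
  optimal_length (volatile e) t.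

Definition is_frac_toppling_number (R : realType) (p : R) (V : finType)
    (e : rel V) (t : nat) : Prop :=
  optimal_length (fun c => frac_volatile p e (fun v => (c v)%:R)) t.

(* Main.v *)
(* Volatility in the fractional game is an up-closed property A of real chip
   configurations, and c is volatile in the ordinary game iff A (p * c). Thus
   both games have the same target A and differ only in the weight of a chip
   (p and 1). For any up-closed A, Min can turn a strategy for chips of weight
   b into one for chips of weight a: Max's real chips are converted into
   imaginary moves of Max as soon as enough weight has accumulated, and Min
   answers with a chip on a vertex where the weight prescribed by the imaginary
   play most exceeds the weight placed. The two plays then stay within O(n) of
   each other in total weight, and once the imaginary play is over Min makes
   up the remaining deficit. Applied with (a, b) = (1, p) and (p, 1), this
   gives both inequalities. *)
Require Import Defs.
From HB Require Import structures.
From mathcomp Require Import all_boot all_order all_algebra reals.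
From mathcomp Require Import boolp lra zify.

Set Implicit Arguments.
Unset Strict Implicit.
Unset Printing Implicit Defensive.

Import Order.TTheory GRing.Theory Num.Theory.

Local Open Scope ring_scope.

Lemma ltr_sum_fin (R : numDomainType) (V : finType) (F G : V -> R) :
  (0 < #|V|)%N -> (forall v, F v < G v) -> \sum_v F v < \sum_v G v.
Proof.
move=> /card_gt0P[v _] ltFG; apply: ltr_sum => //.
by apply/hasP; exists v; rewrite ?mem_index_enum.
Qed.

(** * Backward induction for games of placing chips *)

Section Game.
Variable V : finType.
Implicit Types (c b x : V -> nat) (over : (V -> nat) -> Prop) (h : seq V).

Definition add_chip c (v : V) : V -> nat := fun w => (c w + (w == v))%N.

Definition total c : nat := (\sum_v c v)%N.

Definition upclosed over : Prop :=
  forall c b, (forall v, (c v <= b v)%N) -> over c -> over b.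

Fixpoint min_wins over (k : nat) (max_turn : bool) c : Prop :=
  over c \/
  if k is k'.+1 then
    if max_turn then forall v, min_wins over k' false (add_chip c v)
    else exists v, min_wins over k' true (add_chip c v)
  else False.

Lemma total_add_chip c v : total (add_chip c v) = (total c).+1.
Proof.
rewrite /total big_split -addn1 /=; congr addn.
by rewrite (bigD1 v) //= eqxx big1 // => w /negbTE ->.
Qed.

Lemma chips_rcons h v : chips (rcons h v) = add_chip (chips h) v.
Proof.
by apply/funext => w; rewrite /chips /add_chip -cats1 count_cat /= addn0 eq_sym.
Qed.

Lemma over_min_wins over k turn c : over c -> min_wins over k turn c.
Proof. by case: k => [|k] oc; left. Qed.

Lemma min_wins_upclosed over k turn : upclosed over ->
  upclosed (min_wins over k turn).
Proof.
move=> mono; elim: k turn => [|k IH] turn c b le_cb /=.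
  by case=> // oc; left; apply: mono oc.
case=> [oc|]; first by left; apply: mono oc.
have le_add v w : (add_chip c v w <= add_chip b v w)%N by rewrite leq_add2r.
by case: turn => [H|[v H]]; right;
  [move=> v; apply: IH (H v) | exists v; apply: IH H].
Qed.

Lemma bounded_min_wins over (N : nat) k turn c : (0 < #|V|)%N ->
  (forall c, (N <= total c)%N -> over c) ->
  (N <= total c + k)%N -> min_wins over k turn c.
Proof.
move=> /card_gt0P[v0 _] bnd; elim: k turn c => [|k IH] turn c le_N.
  by left; apply: bnd; rewrite addn0 in le_N.
have next v t : min_wins over k t (add_chip c v).
  by apply: IH; rewrite total_add_chip addSnnS.
by right; case: turn => [v|]; [|exists v0].
Qed.

(** Max preserves the failure of [min_wins] with budget [L.-1 - j] after [j] chips. A finished game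
    is a win for Min at any budget, so the game is not over before [L] chips. *)
Lemma max_strategy over L : (0 < #|V|)%N ->
  (forall k, min_wins over k true (chips [::]) -> (L <= k)%N) ->
  exists smax : seq V -> V, forall (smin : seq V -> V) (k : nat),
     ends_at over smax smin k -> (L <= k)%N.
Proof.
move=> /card_gt0P[v0 _] minL.
pose good h v := ~ min_wins over (L.-1 - (size h).+1) false (chips (rcons h v)).
exists (fun h => odflt v0 [pick v | `[< good h v >]]) => smin k [over_k _].
set smax := fun h : seq V => _ in over_k *.
rewrite leqNgt; apply/negP => lt_kL.
have size_play j : size (play smax smin j) = j.
  by elim: j => //= j IH; rewrite size_rcons IH.
suff lose j : (j < L)%N ->
    ~ min_wins over (L.-1 - j) (~~ odd j) (chips (play smax smin j)).
  by apply: (lose k lt_kL); apply: over_min_wins.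
elim: j => [|j IH] lt_jL.
  by rewrite /= subn0 => /minL; rewrite leqNgt prednK ?leqnn.
move/(_ (ltnW lt_jL)) in IH.
have Er : (L.-1 - j = (L.-1 - j.+1).+1)%N by lia.
rewrite Er /= in IH; rewrite /=.
case: (odd j) IH => /= IH win; apply: IH; right.
  by exists (smin (play smax smin j)); rewrite -chips_rcons.
move=> v; apply: contrapT => bad_v; move: win.
rewrite /smax; case: pickP => [w /asboolP|/(_ v) /asboolP[]] /=.
  by rewrite /good size_play.
by rewrite /good size_play chips_rcons.
Qed.

(** Min preserves [min_wins] with the remaining budget until the game is over. *)
Lemma min_strategy over L : (0 < #|V|)%N ->
  min_wins over L true (chips [::]) ->
  exists smin : seq V -> V, forall smax : seq V -> V,
     exists2 k : nat, ends_at over smax smin k & (k <= L)%N.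
Proof.
move=> /card_gt0P[v0 _] winL.
pose good h v := min_wins over (L - (size h).+1) true (chips (rcons h v)).
exists (fun h => odflt v0 [pick v | `[< good h v >]]) => smax.
set smin := fun h : seq V => _.
have size_play j : size (play smax smin j) = j.
  by elim: j => //= j IH; rewrite size_rcons IH.
have win j : (j <= L)%N ->
    (exists2 i, (i <= j)%N & over (chips (play smax smin i))) \/
    min_wins over (L - j) (~~ odd j) (chips (play smax smin j)).
  elim: j => [|j IH] le_jL; first by right; rewrite subn0.
  case: (IH (ltnW le_jL)) => [[i le_ij oi]|].
    by left; exists i => //; apply: leqW.
  have -> : (L - j = (L - j.+1).+1)%N by lia.
  case=> [oj|]; first by left; exists j; rewrite ?leqnSn.
  rewrite /=; case: (odd j) => /= [[v win_v]|win_v]; right; last first.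
    by rewrite chips_rcons; apply: win_v.
  rewrite /smin; case: pickP => [w /asboolP|/(_ v) /asboolP[]] /=.
    by rewrite /good size_play.
  by rewrite /good size_play chips_rcons.
have [k le_kL ok] : exists2 i, (i <= L)%N & over (chips (play smax smin i)).
  have [//|] := win L (leqnn L).
  by rewrite subnn => -[oL|//]; exists L.
(* [ends_at] asks for the first time at which the game is over, hence the least such index. *)
have ex : exists i, `[< over (chips (play smax smin i)) >] by exists k; apply/asboolP.
case: (ex_minnP ex) => i /asboolP oi mini; exists i.
  split=> // j lt_ji oj.
  by move/asboolP: oj => /mini; rewrite leqNgt lt_ji.
by apply: leq_trans le_kL; apply: mini; apply/asboolP.
Qed.

Lemma optimal_length_exists over (N : nat) : (0 < #|V|)%N ->
  (forall c, (N <= total c)%N -> over c) ->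
  exists L, [/\ optimal_length over L, min_wins over L true (fun=> 0%N) &
    forall k, min_wins over k true (fun=> 0%N) -> (L <= k)%N].
Proof.
move=> V0 bnd.
have ex : exists k, `[< min_wins over k true (fun=> 0%N) >].
  by exists N; apply/asboolP/(bounded_min_wins _ V0 bnd); rewrite leq_addl.
case: (ex_minnP ex) => L /asboolP winL minL; exists L.
have minL' k : min_wins over k true (fun=> 0%N) -> (L <= k)%N.
  by move=> w; apply/minL/asboolP.
by split=> //; split; [apply: max_strategy | apply: min_strategy].
Qed.

(** Min places the chips of [x] one by one; by monotonicity Max's moves in between cannot hurt. Each
    chip costs two turns, plus one if Max is to move. *)
Lemma fill_min_wins over k (turn : bool) c x : upclosed over ->
  over (fun v => c v + x v)%N -> (2 * total x + turn <= k)%N ->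
  min_wins over k turn c.
Proof.
move=> mono; elim: k turn c x => [|k IH] turn c x ox le_k.
  left; apply: mono ox => v.
  suff -> : x v = 0%N by rewrite addn0.
  have : total x = 0%N by lia.
  by rewrite /total => /eqP; rewrite sum_nat_eq0 => /forall_inP/(_ v isT)/eqP.
case: (pickP (fun v => (0 < x v)%N)) => [v xv|x0]; last first.
  left; apply: mono ox => v.
  by have := x0 v; case: (x v) => //; rewrite addn0.
right; case: turn le_k => [le_k w|le_k].
  apply: (IH _ _ x) => //; last by lia.
  by apply: mono ox => u; rewrite leq_add2r leq_addr.
have Ex : total x = (total (fun w => x w - (w == v))%N).+1.
  rewrite -(total_add_chip _ v); apply: eq_bigr => w _.
  by rewrite /add_chip; case: eqP => [->|_]; [rewrite subnK | rewrite subn0 addn0].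
exists v; apply: (IH _ _ (fun w => x w - (w == v))%N); last by lia.
apply: mono ox => w; rewrite /add_chip.
by case: eqP => [->|_]; lia.
Qed.

End Game.

(** * Comparison of games with one target and two chip weights *)

Section Scaling.
Variables (R : realType) (V : finType) (A : (V -> R) -> Prop).
Hypothesis A_mono : forall x y, (forall v, x v <= y v) -> A x -> A y.
Hypothesis V0 : (0 < #|V|)%N.

Definition scaled (a : R) (c : V -> nat) : Prop := A (fun v => a * (c v)%:R).

Lemma scaled_upclosed a : 0 <= a -> upclosed (scaled a).
Proof.
by move=> a0 c b le_cb; apply: A_mono => v; rewrite ler_wpM2l ?ler_nat.
Qed.

Lemma total_natr (c : V -> nat) : (total c)%:R = \sum_v (c v)%:R :> R.
Proof. exact: natr_sum. Qed.

Variables a b : R.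
Hypotheses (a0 : 0 < a) (a_le1 : a <= 1) (b0 : 0 < b) (b_le1 : b <= 1).

(* [b1], [c1] are Max's imaginary and real chips, [b2], [c2] are Min's. *)
Lemma catch_up (c1 : V -> nat) j (b1 b2 : V -> nat) :
  (forall v, b * (b1 v)%:R <= a * (c1 v)%:R) ->
  total b1 = total b2 ->
  min_wins (scaled b) j true (fun v => b1 v + b2 v)%N ->
  exists b1' b2' : V -> nat,
    [/\ forall v, b * (b1' v)%:R <= a * (c1 v)%:R,
        forall v, (b2 v <= b2' v)%N &
        (total b2' <= total b1')%N /\ scaled b (fun v => b1' v + b2' v)%N \/
        exists j', [/\ forall v, a * (c1 v)%:R < b * (b1' v)%:R + b,
          total b1' = total b2',
          (j' + 2 * total b1' = j + 2 * total b1)%N &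
          min_wins (scaled b) j' true (fun v => b1' v + b2' v)%N]].
Proof.
have mono := scaled_upclosed (ltW b0).
elim/ltn_ind: j b1 b2 => j IH b1 b2 le_bc eq_b win.
(* A vertex with at least [b] of unconverted weight gets an imaginary chip of Max, answered by Min's
   winning move. *)
case: (pickP (fun v => b * (b1 v)%:R + b <= a * (c1 v)%:R)) => [v le_v|paused];
    last first.
  exists b1, b2; split=> //; right; exists j; split=> // v.
  by rewrite ltNge paused.
have le_bc' u : b * (add_chip b1 v u)%:R <= a * (c1 u)%:R.
  rewrite /add_chip natrD mulrDr.
  by case: eqP => [->|_]; rewrite ?mulr1 // mulr0 addr0.
case: j IH win => [|j] IH [ov|win] //;
  try by exists b1, b2; split=> //; left; rewrite eq_b.
have {}win := min_wins_upclosed mono _ (win v).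
have {}win : min_wins (scaled b) j false (fun u => add_chip b1 v u + b2 u)%N.
  by apply: win => u; rewrite /add_chip; lia.
(* The imaginary play may end on Max's move, with Min one chip behind; hence only an inequality of
   totals in this outcome. *)
have now : scaled b (fun u => add_chip b1 v u + b2 u)%N ->
    (total b2 <= total (add_chip b1 v))%N /\
    scaled b (fun u => add_chip b1 v u + b2 u)%N.
  by rewrite total_add_chip eq_b.
case: j IH win => [|j] IH [ov|win] //;
  try by exists (add_chip b1 v), b2; split=> //; left; apply: now.
case: win => w win.
have [] := IH j _ (add_chip b1 v) (add_chip b2 w) le_bc'.
- by [].
- by rewrite !total_add_chip eq_b.
- by apply: (min_wins_upclosed mono) win => u; rewrite /add_chip; lia.
move=> b1' [b2' [le1 le2 H]]; exists b1', b2'; split=> // [u|].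
  by apply: leq_trans (le2 u); rewrite leq_addr.
case: H => [|[j' [? ? E ?]]]; first by left.
right; exists j'; split=> //; rewrite total_add_chip in E; lia.
Qed.

(* Min's real chips may exceed the imaginary ones by at most [a + b] in weight
   at each vertex; as the totals nearly agree, this also bounds the deficits. *)
Lemma simulate m (c1 c2 : V -> nat) j (b1 b2 : V -> nat) :
  (forall v, b * (b1 v)%:R <= a * (c1 v)%:R) ->
  (forall v, a * (c1 v)%:R < b * (b1 v)%:R + b) ->
  (forall v, a * (c2 v)%:R <= b * (b2 v)%:R + (a + b)) ->
  total c1 = total c2 -> total b1 = total b2 ->
  min_wins (scaled b) j true (fun v => b1 v + b2 v)%N ->
  b * (j + 2 * total b1)%:R + 11 * #|V|%:R <= a * (m + 2 * total c1)%:R ->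
  min_wins (scaled a) m true (fun v => c1 v + c2 v)%N.
Proof.
have mono := scaled_upclosed (ltW a0).
have n1 : 1 <= #|V|%:R :> R by rewrite ler1n.
have sumV (x : R) : \sum_(v : V) x = #|V|%:R * x by rewrite sumr_const mulr_natl.
have bn : b * #|V|%:R <= #|V|%:R by rewrite ler_piMl // ltW.
have an : a * #|V|%:R <= #|V|%:R by rewrite ler_piMl // ltW.
elim/ltn_ind: m c1 c2 j b1 b2 => m IH c1 c2 j b1 b2 le_bc paused surplus.
move=> eq_c eq_b win budget.
have lag : a * (total c1)%:R <= b * (total b1)%:R + b * #|V|%:R.
  rewrite !total_natr !mulr_sumr [b * _]mulrC -sumV -big_split.
  by apply: ler_sum => v _; apply: ltW.
(* Both [m + 2 * total c1] and [j + 2 * total b1] are constant along the simulation. Twice [lag]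
   costs at most 2 of the 11 in [budget]. *)
have m_big : 9 * #|V|%:R <= a * m%:R.
  rewrite (natrD _ j) (natrD _ m) !(natrM _ 2) in budget.
  have : 0 <= b * j%:R by rewrite mulr_ge0 // ltW.
  lra.
have m2 : (2 <= m)%N.
  rewrite leqNgt; apply/negP => m_lt2.
  have : a * m%:R <= 1 by rewrite mulr_ile1 ?(ltW a0) ?ler0n // lern1 -ltnS.
  lra.
case: m IH m2 budget m_big => [//|[//|m]] IH _ budget m_big.
right=> v.
have le_bc' u : b * (b1 u)%:R <= a * (add_chip c1 v u)%:R.
  by apply: le_trans (le_bc u) _; rewrite ler_wpM2l ?ler_nat ?leq_addr // ltW.
have [b1' [b2' [le1 le2 H]]] := catch_up le_bc' eq_b win.
have surplus' u : a * (c2 u)%:R <= b * (b2' u)%:R + (a + b).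
  apply: le_trans (surplus u) _.
  by rewrite lerD2r ler_wpM2l ?ler_nat // ltW.
case: H => [[le_b ov]|[j' [paused' eq_b' Ej win']]].
  (* The imaginary play is over: Min covers the deficit [d] with [x] chips. *)
  pose d u := b * (b2' u)%:R - a * (c2 u)%:R.
  pose x u := (Num.truncn (d u / a)).+1.
  (* [d u] may be negative, where [truncn] returns 0; the shift by [a + b] makes it nonnegative by
     [surplus']. *)
  have le_x u : a * (x u)%:R <= d u + (2 * a + b).
    have pos : 0 <= (d u + (a + b)) / a.
      by rewrite divr_ge0 ?(ltW a0) // /d; have := surplus' u; lra.
    have : (x u)%:R <= (d u + (a + b)) / a + 1.
      rewrite /x -natr1 lerD2r.
      apply: le_trans (_ : (Num.truncn ((d u + (a + b)) / a))%:R <= _).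
        rewrite ler_nat; apply: le_truncn.
        by rewrite ler_pM2r ?invr_gt0 // lerDl addr_ge0 ?ltW.
      by rewrite truncn_le.
    rewrite -(ler_pM2l a0) => /le_trans; apply.
    rewrite mulrDr mulrCA divff ?gt_eqF // !mulr1; lra.
  have tot_x : a * (total x)%:R <= a + (2 * a + b) * #|V|%:R.
    have : a * (total x)%:R <=
        b * (total b2')%:R - a * (total c2)%:R + #|V|%:R * (2 * a + b).
      rewrite !total_natr !mulr_sumr -sumV -sumrB -big_split.
      by apply: ler_sum => u _; apply: le_x.
    have : b * (total b2')%:R <= a * (total (add_chip c1 v))%:R.
      apply: (@le_trans _ _ (b * (total b1')%:R)).
        by rewrite ler_wpM2l ?ler_nat // ltW.
      by rewrite !total_natr !mulr_sumr; apply: ler_sum.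
    rewrite total_add_chip -natr1 eq_c; lra.
  apply: (@fill_min_wins _ _ _ _ _ x) => //.
    apply: A_mono ov => u; rewrite !natrD !mulrDr.
    have : d u <= a * (x u)%:R.
      by rewrite -ler_pdivrMl // mulrC ltW // truncnS_gt.
    have := le1 u; rewrite /add_chip natrD mulrDr /d; lra.
  (* Twice the bound [tot_x] is at most [8 * #|V|], below the [9 * #|V|] of [m_big]. *)
  rewrite addn0 -ltnS -(ltr_nat R) -(ltr_pM2l a0) natrM.
  nra.
(* Averaging: Min's totals match Max's, which [paused'] bounds. A chip on [w] then gives an excess
   of at most [a + b]. *)
have [w dw] : exists w, a * (c2 w)%:R <= b * (b2' w)%:R + b.
  apply: contrapT => none.
  have : \sum_v (b * (b2' v)%:R + b) < \sum_v a * (c2 v)%:R.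
    apply: ltr_sum_fin => // u.
    by rewrite ltNge; apply/negP => ?; apply: none; exists u.
  have : \sum_u a * (add_chip c1 v u)%:R <= \sum_u (b * (b1' u)%:R + b).
    by apply: ler_sum => u _; apply: ltW.
  rewrite !big_split /= -!mulr_sumr -!total_natr total_add_chip -eq_b' -eq_c.
  rewrite -natr1; have := a0; lra.
rewrite /=; right; exists w.
apply: (min_wins_upclosed mono (c := fun u => add_chip c1 v u + add_chip c2 w u)%N).
  by move=> u; rewrite /add_chip; lia.
apply: (IH m _ _ _ j' b1' b2') => //.
- move=> u; rewrite /add_chip natrD mulrDr; case: eqP => [->|_].
    by rewrite mulr1; lra.
  by rewrite mulr0 addr0.
- by rewrite !total_add_chip eq_c.
- by rewrite Ej total_add_chip; congr (_ <= a * _%:R): budget; lia.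
Qed.

(** Otherwise [simulate], from the empty position, lets Min win within [t - 1] chips. The budget
    takes 11 of the 12, and the chip lost in [t - 1] weighs [a <= 1 <= #|V|]. *)
Lemma scaled_length_le (t s : nat) :
  (forall k, min_wins (scaled a) k true (fun=> 0%N) -> (t <= k)%N) ->
  min_wins (scaled b) s true (fun=> 0%N) ->
  a * t%:R <= b * s%:R + 12 * #|V|%:R.
Proof.
move=> min_t win_s.
have n1 : 1 <= #|V|%:R :> R by rewrite ler1n.
case: t min_t => [|t] min_t.
  by rewrite mulr0 addr_ge0 // mulr_ge0 // ltW.
rewrite leNgt; apply/negP => lt_t.
have := min_t t; rewrite ltnn => H; apply: notF; apply: H.
have z : total (fun _ : V => 0%N) = 0%N by apply: big1.
apply: (@simulate t (fun=> 0%N) (fun=> 0%N) s (fun=> 0%N) (fun=> 0%N)) => // [v|v|v|].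
- by rewrite !mulr0.
- by rewrite !mulr0 add0r.
- by rewrite !mulr0 add0r addr_ge0 // ltW.
- rewrite z muln0 !addn0; move: lt_t; rewrite -natr1; have := a_le1; lra.
Qed.

End Scaling.

(** * Scaling and chip conservation for volatility on graphs *)

Section Graph.
Variables (R : realType) (V : finType) (e : rel V) (p : R).
Hypotheses (p0 : 0 < p) (e_irr : irreflexive e).

Lemma frac_volatile_mono (x y : V -> R) :
  (forall v, x v <= y v) -> frac_volatile p e x -> frac_volatile p e y.
Proof.
move=> le_xy [s Hs]; exists s => k; apply: le_trans (Hs k) _.
elim: k (s k) => [|k IH] v //=.
by rewrite /frac_fire; case: eqP => _; rewrite lerD2r.
Qed.

(** Legality makes the truncated subtraction in [fire] exact, so firing commutes with scaling. *)
Lemma frac_fire_seq_scaled (c : V -> nat) s k :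
  (forall j, (j < k)%N -> (degree e (s j) <= fire_seq e c s j (s j))%N) ->
  frac_fire_seq p e (fun v => p * (c v)%:R) s k =
  (fun v => p * (fire_seq e c s k v)%:R).
Proof.
elim: k => [|k IH] legal //=; rewrite IH => [|j lt_jk]; last first.
  by apply/legal/ltnW.
apply/funext => v; rewrite /frac_fire /fire; case: eqP => [->|_].
  by rewrite natrB ?mulrBr //; apply: legal.
by rewrite natrD mulrDr.
Qed.

Lemma frac_volatile_scaled (c : V -> nat) :
  frac_volatile p e (fun v => p * (c v)%:R) <-> volatile e c.
Proof.
split=> -[s Hs]; exists s => k.
  (* Step [k] can be compared only once all earlier firings are known to be legal in the ordinary
     game. *)
  elim/ltn_ind: k => k legal; have := Hs k.
  by rewrite frac_fire_seq_scaled // ler_pM2l // ler_nat.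
by rewrite frac_fire_seq_scaled // ler_pM2l // ler_nat.
Qed.

(** Without loops, everything removed from [v] goes to other vertices. *)
Lemma sum_frac_fire (x : V -> R) v : \sum_w frac_fire p e x v w = \sum_w x w.
Proof.
rewrite (bigD1 v) //= [RHS](bigD1 v) //= /frac_fire eqxx -addrA; congr (_ + _).
rewrite (eq_bigr (fun w => x w + p * (e v w)%:R)); last by move=> w /negbTE ->.
rewrite big_split /= addrCA -mulr_sumr -natr_sum.
suff -> : (\sum_(w | w != v) e v w = degree e v)%N by rewrite addNr addr0.
rewrite /degree -sum1_card [RHS]big_mkcond [RHS](bigD1 v) //= inE e_irr add0n.
by apply: eq_bigr => w _; rewrite inE; case: (e v w).
Qed.

Lemma large_frac_volatile (x : V -> R) : (0 < #|V|)%N ->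
  \sum_v p * (degree e v)%:R <= \sum_v x v -> frac_volatile p e x.
Proof.
move=> V0 large; have /card_gt0P[v0 _] := V0.
pose next y := odflt v0 [pick v | p * (degree e v)%:R <= y v].
pose state k := iter k (fun y => frac_fire p e y (next y)) x.
have stateE k : frac_fire_seq p e x (fun k => next (state k)) k = state k.
  by elim: k => //= k ->.
exists (fun k => next (state k)) => k; rewrite stateE.
have sum_state : \sum_v state k v = \sum_v x v.
  by elim: k => //= k IH; rewrite sum_frac_fire.
move: (state k) sum_state => y sum_y; rewrite /next; case: pickP => //= none.
have : \sum_v y v < \sum_v p * (degree e v)%:R.
  by apply: ltr_sum_fin => // v; rewrite ltNge none.
by rewrite sum_y ltNge large.
Qed.

End Graph.

Theorem theorem3p1 (R : realType) :
  exists C : R,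
    forall (p : R) (n : nat) (V : finType) (e : rel V),
      0 < p -> p < 1 -> (0 < n)%N -> #|V| = n ->
      symmetric e -> irreflexive e ->
      exists t tp : nat,
        [/\ is_toppling_number e t,
            is_frac_toppling_number p e tp
          & `|tp%:R - p * t%:R| <= C * n%:R].
Proof.
exists 12 => p n V e p0 p1 n0 Vn _ e_irr.
have V0 : (0 < #|V|)%N by rewrite Vn.
have mono := @frac_volatile_mono R V e p.
have game a : 0 < a -> exists L,
    [/\ optimal_length (scaled (frac_volatile p e) a) L,
        min_wins (scaled (frac_volatile p e) a) L true (fun=> 0%N) &
        forall k, min_wins (scaled (frac_volatile p e) a) k true (fun=> 0%N) ->
          (L <= k)%N].
  move=> a0; pose S := \sum_v p * (degree e v)%:R.
  (* Total weight [S] forces volatility, and this many chips of weight [a] exceed it. *)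
  apply: (@optimal_length_exists _ _ (Num.truncn (S / a)).+1) => // c le_c.
  apply: large_frac_volatile => //; rewrite -[leRHS]mulr_sumr -natr_sum -ler_pdivrMl //.
  rewrite mulrC; apply: le_trans (ltW (truncnS_gt _)) _.
  by rewrite ler_nat.
have [t [opt_t win_t min_t]] := game p p0.
have [tp [opt_tp win_tp min_tp]] := game 1 ltr01.
exists t, tp; split.
- rewrite /is_toppling_number.
  suff -> : volatile e = scaled (frac_volatile p e) p by [].
  by apply/funext => c; apply/propext; split=> /(frac_volatile_scaled _ p0).
- rewrite /is_frac_toppling_number; congr optimal_length: opt_tp.
  by apply/funext => c; rewrite /scaled; under eq_fun do rewrite mul1r.
have le1 := scaled_length_le mono V0 ltr01 (lexx 1) p0 (ltW p1) min_tp win_t.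
have le2 := scaled_length_le mono V0 p0 (ltW p1) ltr01 (lexx 1) min_t win_tp.
by rewrite ler_norml -Vn; apply/andP; split; lra.
Qed.
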